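(* Let $q>1$ be an integer, let $P=(p_0,\dots,p_{q-1})$ and $R=(r_0,\dots,r_{q-1})$ satisfy $p_j>0$, $r_j>0$ for all $j$, $\sum_j p_j=1$ and $\sum_j r_j=1$. Let $(n_k)_{k\ge1}$ be a sequence of positive integers with $n_i\ne n_j$ for $i\neq j$ and such that for every $n\in\mathbb N$ there is $k_0$ with $n_{k_0}=n$. Let $$G(s)=\gamma_{i_{n_1}}+\sum_{k=2}^{\infty}\left(\gamma_{i_{n_k}}\prod_{t=1}^{k-1}r_{i_{n_t}}\right),\qquad s=\Delta^P_{i_1i_2\ldots i_k\ldots}\in[0,1].$$ Then the Lebesgue integral of $G$ is given by $$\int_0^1 G(s)\,ds=\frac{\gamma_1p_1+\gamma_2p_2+\dots+\gamma_{q-1}p_{q-1}}{1-p_0r_0-p_1r_1-\dots-p_{q-1}r_{q-1}}.$$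
   Context: For $i\in\{0,\dots,q-1\}$ put $\beta_0=\gamma_0=0$ and, for $i\ne0$, $\beta_i=\sum_{l=0}^{i-1}p_l$, $\gamma_i=\sum_{l=0}^{i-1}r_l$. For digits $i_k\in\{0,1,\dots,q-1\}$ write $$\Delta^P_{i_1i_2\ldots i_k\ldots}:=\beta_{i_1}+\sum_{k=2}^\infty\Big(\beta_{i_k}\prod_{j=1}^{k-1}p_{i_j}\Big)\in[0,1].$$ Every $s\in[0,1]$ has such a representation; it is unique except for the countably many numbers $\Delta^P_{i_1\ldots i_{m-1}i_m000\ldots}=\Delta^P_{i_1\ldots i_{m-1}[i_m-1][q-1][q-1]\ldots}$ with $i_m\ne0$, which have two. *)

(* Defs.v *)
From HB Require Import structures.
From mathcomp Require Import all_boot all_order all_algebra.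
From mathcomp Require Import all_classical all_reals all_analysis.
Set Implicit Arguments.
Unset Strict Implicit.
Unset Printing Implicit Defensive.
Import Order.TTheory GRing.Theory Num.Theory.
Import numFieldNormedType.Exports.
Local Open Scope classical_set_scope.
Local Open Scope ring_scope.

(* [cumul p] is beta and [cumul r] is gamma; the empty sum gives the value 0 at
   the digit 0. *)
Definition cumul (R : realType) (q : nat) (v : 'I_q -> R) (i : 'I_q) : R :=
  \sum_(l < q | (l < i)%N) v l.

(* Digit sequences are indexed from 1: the value [i 0%N] is never used.
   [expansion p i] is Delta^P_{i_1 i_2 ...}. The series has nonnegative terms
   and converges geometrically when v is a positive probability vector and
   1 < q, so the limit of its partial sums is its actual sum. *)
Definition expansion (R : realType) (q : nat) (v : 'I_q -> R)
    (i : nat -> 'I_q) : R :=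
  cumul v (i 1%N) +
  \big[+%R/0]_(2 <= k <oo) (cumul v (i k) * \prod_(1 <= j < k) v (i j)).

(* n_1, n_2, ... are positive, pairwise distinct and exhaust the positive
   integers; the value [n 0%N] is never used. *)
Definition digit_rearrangement (n : nat -> nat) : Prop :=
  [/\ forall k, (0 < k)%N -> (0 < n k)%N,
      forall i j, (0 < i)%N -> (0 < j)%N -> i <> j -> n i <> n j
    & forall m, (0 < m)%N -> exists2 k, (0 < k)%N & n k = m].

(* The digit formula for G depends on the representation of s at the countably
   many s which have two of them. G is allowed to use either representation at
   each such point; requiring the formula for both would in general be
   contradictory. *)
Definition digit_rearranging_function (R : realType) (q : nat)
    (p r : 'I_q -> R) (n : nat -> nat) (G : R -> R) : Prop :=
  forall s : R, s \in `[0, 1] ->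
    exists2 i : nat -> 'I_q,
      s = expansion p i & G s = expansion r (fun k => i (n k)).

(* Main.v *)
(* Choose for each s the digits used by G. The numbers whose first M digits are
   prescribed fill an interval of length the product of the corresponding p_j,
   up to its endpoints, so under Lebesgue measure the digits are independent with
   law p. As n is injective, the k-th term of the series of G is a product of
   functions of distinct digits, with integral B A^(k-1), where A = sum p_j r_j
   and B = sum gamma_j p_j. All terms are nonnegative, so monotone convergence
   gives the sum of the geometric series, B / (1 - A). *)
Require Import Defs.
From HB Require Import structures.
From mathcomp Require Import all_boot all_order all_algebra.
From mathcomp Require Import all_classical all_reals all_analysis.
From mathcomp Require Import measurable_realfun.
Set Implicit Arguments.
Unset Strict Implicit.
Unset Printing Implicit Defensive.
Import Order.TTheory GRing.Theory Num.Theory.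
Import numFieldNormedType.Exports.
Local Open Scope classical_set_scope.
Local Open Scope ring_scope.

(** * Nested cylinder intervals and convergence of expansions *)

(* Here digit sequences start at index 0. The numbers whose expansion begins
   with x 0, ..., x (K - 1) fill the interval with left endpoint
   [cyl_left v x K] and length [cyl_width v x K]. *)
Definition cyl_width (R : realType) (q : nat) (v : 'I_q -> R)
    (x : nat -> 'I_q) (K : nat) : R := \prod_(j < K) v (x j).

Definition cyl_left (R : realType) (q : nat) (v : 'I_q -> R)
    (x : nat -> 'I_q) (K : nat) : R :=
  \sum_(k < K) cumul v (x k) * cyl_width v x k.

Lemma cumul_ge0 (R : realType) (q : nat) (v : 'I_q -> R) (i : 'I_q) :
  (forall j, 0 < v j) -> 0 <= cumul v i.
Proof. by move=> v0; apply: sumr_ge0 => l _; apply/ltW. Qed.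

Lemma cumul_lt (R : realType) (q : nat) (v : 'I_q -> R) (i j : 'I_q) :
  (forall j, 0 < v j) -> (i < j)%N -> cumul v i + v i <= cumul v j.
Proof.
move=> v0 ij; rewrite /cumul addrC [leRHS](bigD1 i) //= lerD2l.
rewrite [leLHS]big_mkcond [leRHS]big_mkcond /=.
apply: ler_sum => l _; case: (ltnP l i) => li.
  by rewrite (ltn_trans li ij) -val_eqE /= neq_ltn li.
by case: ifP => // _; apply/ltW.
Qed.

Lemma cumulD_le1 (R : realType) (q : nat) (v : 'I_q -> R) (i : 'I_q) :
  (forall j, 0 < v j) -> \sum_(j < q) v j = 1 -> cumul v i + v i <= 1.
Proof.
move=> v0 <-; rewrite /cumul addrC [leRHS](bigD1 i) //= lerD2l.
rewrite [leLHS]big_mkcond [leRHS]big_mkcond /=.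
apply: ler_sum => l _; case: (ltnP l i) => li.
  by rewrite -val_eqE /= neq_ltn li.
by case: ifP => // _; apply/ltW.
Qed.

Lemma cyl_width0 (R : realType) (q : nat) (v : 'I_q -> R) x :
  cyl_width v x 0 = 1.
Proof. exact: big_ord0. Qed.

Lemma cyl_left0 (R : realType) (q : nat) (v : 'I_q -> R) x :
  cyl_left v x 0 = 0.
Proof. exact: big_ord0. Qed.

Lemma cyl_widthS (R : realType) (q : nat) (v : 'I_q -> R) x K :
  cyl_width v x K.+1 = cyl_width v x K * v (x K).
Proof. exact: big_ord_recr. Qed.

Lemma cyl_leftS (R : realType) (q : nat) (v : 'I_q -> R) x K :
  cyl_left v x K.+1 = cyl_left v x K + cumul v (x K) * cyl_width v x K.
Proof. exact: big_ord_recr. Qed.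

Lemma cyl_width_gt0 (R : realType) (q : nat) (v : 'I_q -> R) x K :
  (forall j, 0 < v j) -> 0 < cyl_width v x K.
Proof. by move=> v0; apply: prodr_gt0 => j _. Qed.

Lemma eq_cyl_width (R : realType) (q : nat) (v : 'I_q -> R) x y K :
  (forall k, (k < K)%N -> x k = y k) -> cyl_width v x K = cyl_width v y K.
Proof. by move=> xy; apply: eq_bigr => j _; rewrite xy. Qed.

Lemma eq_cyl_left (R : realType) (q : nat) (v : 'I_q -> R) x y K :
  (forall k, (k < K)%N -> x k = y k) -> cyl_left v x K = cyl_left v y K.
Proof.
move=> xy; apply: eq_bigr => k _; rewrite xy //; congr (_ * _).
by apply: eq_cyl_width => j jk; rewrite xy // (ltn_trans jk).
Qed.

Lemma cyl_left_homo (R : realType) (q : nat) (v : 'I_q -> R) x :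
  (forall j, 0 < v j) -> {homo cyl_left v x : K L / (K <= L)%N >-> K <= L}.
Proof.
move=> v0; apply/nondecreasing_seqP => K.
by rewrite cyl_leftS lerDl mulr_ge0 ?cumul_ge0 ?(ltW (cyl_width_gt0 _ _ _)).
Qed.

(** Adding a digit replaces the interval by a subinterval: [cumul v i + v i <= 1] keeps the new
    right endpoint from passing the old one. *)
Lemma cyl_right_homo (R : realType) (q : nat) (v : 'I_q -> R) x :
  (forall j, 0 < v j) -> \sum_(j < q) v j = 1 ->
  {homo (fun K => cyl_left v x K + cyl_width v x K) :
     K L / (K <= L)%N >-> L <= K}.
Proof.
move=> v0 v1; apply/nonincreasing_seqP => K.
rewrite cyl_leftS cyl_widthS -addrA lerD2l [cyl_width _ _ _ * _]mulrC -mulrDl.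
by rewrite ler_piMl ?(ltW (cyl_width_gt0 _ _ _)) ?cumulD_le1.
Qed.

(** The left endpoints are the partial sums of the expansion. They increase and stay below the right
    endpoints, which decrease from 1, so they converge. *)
Lemma cyl_left_cvg (R : realType) (q : nat) (v : 'I_q -> R) (i : nat -> 'I_q) :
  (forall j, 0 < v j) -> \sum_(j < q) v j = 1 ->
  cyl_left v (fun k => i k.+1) K @[K --> \oo] --> expansion v i.
Proof.
move=> v0 v1; set x := fun k => i k.+1.
have cA : cvgn (cyl_left v x).
  apply: nondecreasing_is_cvgn; first exact: cyl_left_homo.
  exists 1 => _ [K _ <-].
  have := cyl_right_homo x v0 v1 (leq0n K).
  rewrite cyl_left0 cyl_width0 add0r; apply: le_trans.
  by rewrite lerDl ltW // cyl_width_gt0.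
suff -> : expansion v i = limn (cyl_left v x) by [].
rewrite /expansion; apply/eqP; rewrite addrC eq_sym -subr_eq; apply/eqP/esym.
(* The series in [expansion] starts at k = 2, so its partial sum up to K + 2 has K terms. Together
   with the separate first term they make up [cyl_left v x K.+1]. *)
apply/cvg_lim => //; rewrite -(cvg_shiftn 2).
rewrite [X in X @ _ --> _](_ : _ =
    fun K => cyl_left v x K.+1 - cumul v (i 1%N)); last first.
  apply/funext => K /=; rewrite (big_addn 0%N _ 2%N) addnK.
  rewrite big_mkord /cyl_left big_ord_recl /cyl_width big_ord0 mulr1 addrC addKr.
  apply: eq_bigr => k _; rewrite addn2 /= big_add1 /= big_mkord.
  by congr (_ * _).
apply: cvgB; last exact: cvg_cst.
by rewrite (cvg_shiftS (cyl_left v x)).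
Qed.

Lemma expansion_cyl (R : realType) (q : nat) (v : 'I_q -> R)
    (i : nat -> 'I_q) K :
  (forall j, 0 < v j) -> \sum_(j < q) v j = 1 ->
  cyl_left v (fun k => i k.+1) K <= expansion v i
  <= cyl_left v (fun k => i k.+1) K + cyl_width v (fun k => i k.+1) K.
Proof.
move=> v0 v1; have cA := cyl_left_cvg (i := i) v0 v1.
rewrite -(cvg_lim (@Rhausdorff R) cA); apply/andP; split.
  apply: nondecreasing_cvgn_le; first exact: cyl_left_homo.
  by apply/cvg_ex; eexists; exact: cA.
apply: limr_le; first by apply/cvg_ex; eexists; exact: cA.
near=> L; have KL : (K <= L)%N by near: L; exact: nbhs_infty_ge.
apply: le_trans (cyl_right_homo _ v0 v1 KL).
by rewrite lerDl ltW // cyl_width_gt0.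
Unshelve. all: by end_near. Qed.

(** At the first digit where the words differ, [cumul_lt] puts the interval of the smaller digit to
    the left of the other. All later intervals are nested in these two, so the order persists. *)
Lemma cyl_separated (R : realType) (q : nat) (v : 'I_q -> R)
    (x y : nat -> 'I_q) K :
  (forall j, 0 < v j) -> \sum_(j < q) v j = 1 ->
  [\/ forall k, (k < K)%N -> x k = y k,
      cyl_left v x K + cyl_width v x K <= cyl_left v y K
    | cyl_left v y K + cyl_width v y K <= cyl_left v x K].
Proof.
move=> v0 v1.
have sep (a b : nat -> 'I_q) L : (forall k, (k < L)%N -> a k = b k) ->
    (a L < b L)%N -> cyl_left v a L.+1 + cyl_width v a L.+1 <= cyl_left v b L.+1.
  move=> ab abL; rewrite !cyl_leftS cyl_widthS (eq_cyl_left _ ab).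
  rewrite (eq_cyl_width _ ab) -addrA lerD2l [cyl_width _ _ _ * _]mulrC -mulrDl.
  by rewrite ler_wpM2r ?cumul_lt // ltW // cyl_width_gt0.
elim: K => [|K [eqK|ltK|gtK]]; first by constructor 1.
- case: (ltngtP (x K) (y K)) => [lt|gt|eq].
  + by constructor 2; apply: sep.
  + by constructor 3; apply: sep => // k kK; rewrite eqK.
  + constructor 1 => k; rewrite ltnS leq_eqVlt => /predU1P[->|]; last exact: eqK.
    exact: val_inj.
- constructor 2; apply: le_trans (cyl_left_homo y v0 (leqnSn K)).
  exact: le_trans (cyl_right_homo x v0 v1 (leqnSn K)) ltK.
- constructor 3; apply: le_trans (cyl_left_homo x v0 (leqnSn K)).
  exact: le_trans (cyl_right_homo y v0 v1 (leqnSn K)) gtK.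
Qed.

(** * Independence of digits for finite words *)

(** Group the factors by the position they read; distributivity then splits the sum over words into
    one sum per position. By injectivity a position is read by at most one factor, and an unread one
    contributes the total mass 1. *)
Lemma expectation_prod_distinct (R : realType) (I J T : finType) (m : I -> J)
    (p : T -> R) (g : I -> T -> R) :
  injective m -> \sum_c p c = 1 ->
  \sum_(w : {ffun J -> T}) (\prod_t g t (w (m t))) * \prod_j p (w j) =
  \prod_t \sum_c g t c * p c.
Proof.
move=> minj p1.
transitivity (\prod_j \sum_c (\prod_(t | m t == j) g t c) * p c).
  rewrite bigA_distr_bigA; apply: eq_bigr => w _; rewrite big_split /=.
  congr (_ * _); rewrite (exchange_big_dep predT) //=; apply: eq_bigr => t _.
  by rewrite (big_pred1 (m t)) // => j; rewrite eq_sym.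
transitivity (\prod_j \prod_(t | m t == j) \sum_c g t c * p c).
  apply: eq_bigr => j _; have [[t mt]|nt] := pselect (exists t, m t = j).
    have P s : (m s == j) = (s == t) by rewrite -mt; apply/eqP/eqP => [/minj|->].
    by rewrite (big_pred1 t) //; apply: eq_bigr => c _; rewrite (big_pred1 t).
  have P s : (m s == j) = false by apply/eqP => ms; apply: nt; exists s.
  rewrite big_pred0 // -[RHS]p1; apply: eq_bigr => c _.
  by rewrite big_pred0 // mul1r.
rewrite (exchange_big_dep predT) //=; apply: eq_bigr => t _.
by rewrite (big_pred1 (m t)) // => j; rewrite eq_sym.
Qed.

(** * Lebesgue measure of cylinders and integrals of digit functions *)

(* Whichever representation [d] selects at the endpoints, the cylinder lies
   between the open and the closed interval with these endpoints; hence it is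
   Borel although nothing is assumed about the measurability of [d]. *)
Lemma cylinder_measure (R : realType) (q : nat) (p : 'I_q -> R)
    (d : R -> nat -> 'I_q) M (w : {ffun 'I_M -> 'I_q}) :
  (forall j, 0 < p j) -> \sum_(j < q) p j = 1 ->
  (forall s, s \in `[0, 1] -> forall K,
    cyl_left p (d s) K <= s <= cyl_left p (d s) K + cyl_width p (d s) K) ->
  let C := [set s : R | s \in `[0, 1] /\ forall j : 'I_M, d s j = w j] in
  measurable C /\ lebesgue_measure C = (\prod_(j < M) p (w j))%:E.
Proof.
move=> p0 p1 hd C.
(* The finite word is extended to a sequence by an arbitrary filler; only its first M digits enter
   the endpoints below. *)
pose x k := if insub k is Some j then w j else d 0 0%N.
have xw (j : 'I_M) : x j = w j by rewrite /x valK.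
have -> : \prod_(j < M) p (w j) = cyl_width p x M.
  by apply: eq_bigr => j _; rewrite xw.
set a := cyl_left p x M; set b := a + cyl_width p x M.
have ab : a < b by rewrite ltrDl cyl_width_gt0.
have a0 : 0 <= a.
  by have := cyl_left_homo x p0 (leq0n M); rewrite cyl_left0.
have b1 : b <= 1.
  have := cyl_right_homo x p0 p1 (leq0n M).
  by rewrite cyl_left0 cyl_width0 add0r.
have Csub : C `<=` [set` `[a, b]].
  move=> s [s01 ds]; have := hd _ s01 M.
  have dx k : (k < M)%N -> d s k = x k.
    by move=> kM; rewrite -[k]/(val (Ordinal kM)) ds xw.
  by rewrite (eq_cyl_left _ dx) (eq_cyl_width _ dx) /= in_itv.
have subC : [set` `]a, b[] `<=` C.
  move=> s; rewrite /= in_itv /= => /andP[as_ sb].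
  have s01 : s \in `[0, 1].
    by rewrite in_itv /= (le_trans a0 (ltW as_)) (le_trans (ltW sb) b1).
  split => // j; rewrite -xw; have /andP[ls sr] := hd _ s01 M.
  have [dx|le|le] := cyl_separated (d s) x M p0 p1; first exact: dx.
    by have := lt_le_trans as_ (le_trans sr le); rewrite ltxx.
  by have := le_lt_trans (le_trans le ls) sb; rewrite ltxx.
have mC : measurable C.
  have -> : C = [set` `]a, b[] `|` (C `&` [set a; b]).
    apply/seteqP; split=> s; last by case=> [/subC|[]].
    move=> Cs; have := Csub _ Cs; rewrite /= !in_itv /=.
    case/andP; rewrite le_eqVlt => /predU1P[sa _|as_]; first by right; split=> //; left.
    rewrite le_eqVlt => /predU1P[sb|sb]; last by left; rewrite as_.
    by right; split=> //; right.
  apply: measurableU; first exact: measurable_itv.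
  apply: countable_measurable => [t|]; first exact: measurable_set1.
  apply: finite_set_countable; apply: sub_finite_set (finite_set2 a b).
  exact: subIsetr.
split=> //; apply/eqP; rewrite eq_le.
(* The booleans select the type of endpoint: [true false] is the closed interval, [false true] the
   open one. Both have the same length, which squeezes the measure of [C]. *)
have mu_itv (c e : bool) : lebesgue_measure [set` Interval (BSide c a) (BSide e b)]
    = (cyl_width p x M)%:E.
  by rewrite lebesgue_measure_itv /= lte_fin ab -EFinB /b addrAC subrr add0r.
apply/andP; split.
  by rewrite -(mu_itv true false) le_measure // inE //; exact: measurable_itv.
by rewrite -(mu_itv false true) le_measure // inE //; exact: measurable_itv.
Qed.

(** On the unit interval [f] is a finite combination of cylinder indicators: at each s exactly one
    word, that of the first M digits, contributes. *)
Lemma integral_word_function (R : realType) (q : nat) (p : 'I_q -> R)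
    (d : R -> nat -> 'I_q) M (F : {ffun 'I_M -> 'I_q} -> R) :
  (forall j, 0 < p j) -> \sum_(j < q) p j = 1 ->
  (forall s, s \in `[0, 1] -> forall K,
    cyl_left p (d s) K <= s <= cyl_left p (d s) K + cyl_width p (d s) K) ->
  (forall w, 0 <= F w) ->
  let f := fun s => (F [ffun j : 'I_M => d s j])%:E in
  measurable_fun (`[0%R, 1%R] : set R) f /\
  (\int[@lebesgue_measure R]_(s in `[0%R, 1%R]) f s)%E =
  (\sum_w F w * \prod_(j < M) p (w j))%:E.
Proof.
move=> p0 p1 hd F0 f.
pose C (w : {ffun 'I_M -> 'I_q}) :=
  [set s : R | s \in `[0, 1] /\ forall j : 'I_M, d s j = w j].
pose h w s := ((F w)%:E * (\1_(C w) s)%:E)%E.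
have mC w : measurable (C w) by have [] := cylinder_measure w p0 p1 hd.
have fE : {in `[0%R, 1%R], forall s, f s = \sum_w h w s}.
  move=> s s01; rewrite (bigD1 [ffun j : 'I_M => d s j]) //= big1 => [|w ws].
    rewrite addr0 /h indicE mem_set ?mule1 //.
    by split=> // j; rewrite ffunE.
  rewrite /h indicE memNset ?mule0 // => -[_ ds]; case/eqP: ws.
  by apply/ffunP => j; rewrite ffunE ds.
have mD : measurable (`[0, 1] : set R) by exact: measurable_itv.
have m1 w : measurable_fun (`[0%R, 1%R] : set R) (fun s => (\1_(C w) s)%:E : \bar R).
  by apply/measurable_EFinP; exact: measurable_indic.
have mh w : measurable_fun (`[0%R, 1%R] : set R) (h w) by exact: measurable_funeM.
split.
  apply: (eq_measurable_fun (fun s => \sum_w h w s)) => [s|].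
    by rewrite inE => /fE ->.
  exact: emeasurable_sum.
transitivity (\int[@lebesgue_measure R]_(s in `[0%R, 1%R]) \sum_w h w s)%E.
  by apply: eq_integral => s; rewrite inE => /fE.
rewrite ge0_integral_sum //; last first.
  by move=> w s _; rewrite /h mule_ge0 ?lee_fin.
rewrite -sumEFin; apply: eq_bigr => w _.
rewrite ge0_integralZl_EFin //; last exact: m1.
rewrite EFinM; congr (_ * _)%E.
have [_ <-] := cylinder_measure w p0 p1 hd.
transitivity (lebesgue_measure (C w `&` `[0, 1])).
  exact: (integral_indic (@lebesgue_measure R) mD (mC w)).
by congr (lebesgue_measure _); apply/setIidPl => s [].
Qed.

Lemma integral_digit_term (R : realType) (q : nat) (p r : 'I_q -> R)
    (d : R -> nat -> 'I_q) (m : nat -> nat) (k : nat) :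
  (forall j, 0 < p j) -> \sum_(j < q) p j = 1 -> (forall j, 0 < r j) ->
  (forall s, s \in `[0, 1] -> forall K,
    cyl_left p (d s) K <= s <= cyl_left p (d s) K + cyl_width p (d s) K) ->
  injective m ->
  let f := fun s =>
    (cumul r (d s (m k)) * cyl_width r (fun j => d s (m j)) k)%:E in
  measurable_fun (`[0%R, 1%R] : set R) f /\
  (\int[@lebesgue_measure R]_(s in `[0%R, 1%R]) f s)%E =
  ((\sum_c cumul r c * p c) * (\sum_c r c * p c) ^+ k)%:E.
Proof.
move=> p0 p1 r0 hd minj f.
(* All positions [m 0], ..., [m k] lie below [M], so the term depends on the first [M] digits
   only. *)
pose M := \max_(t < k.+1) (m t).+1.
have mM (t : 'I_k.+1) : (m t < M)%N by exact: (leq_bigmax t).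
pose m' t := Ordinal (mM t).
have m'inj : injective m' by move=> s t [/minj/val_inj].
(* The last of the k + 1 digits read carries the factor gamma, the earlier ones carry r. *)
pose g (t : 'I_k.+1) c := if t == ord_max then cumul r c else r c.
have widenF (t : 'I_k) : widen_ord (leqnSn k) t == ord_max = false.
  by rewrite -val_eqE /= ltn_eqF.
pose F (w : {ffun 'I_M -> 'I_q}) := \prod_t g t (w (m' t)).
have F0 w : 0 <= F w.
  apply: prodr_ge0 => t _; rewrite /g; case: ifP => _; first exact: cumul_ge0.
  exact: ltW.
have fE : f = fun s => (F [ffun j : 'I_M => d s j])%:E.
  apply/funext => s; rewrite /f /F big_ord_recr /= /g eqxx ffunE mulrC.
  by congr (_ * _)%:E; apply: eq_bigr => t _; rewrite widenF ffunE.
have [mF iF] := integral_word_function p0 p1 hd F0.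
rewrite fE; split=> //; rewrite iF; congr EFin.
rewrite (expectation_prod_distinct g m'inj p1) big_ord_recr /= mulrC /g eqxx.
congr (_ * _); rewrite -[RHS]mulr1 -[k in _ ^+ k](card_ord k) -prodr_const mulr1.
by apply: eq_bigr => t _; rewrite widenF.
Qed.

(** * Summation of the term integrals *)

Theorem theorem4 (R : realType) (q : nat) (hq : (1 < q)%N)
    (p r : 'I_q -> R)
    (hp : forall j, 0 < p j) (hr : forall j, 0 < r j)
    (hp1 : \sum_(j < q) p j = 1) (hr1 : \sum_(j < q) r j = 1)
    (n : nat -> nat) (hn : digit_rearrangement n)
    (G : R -> R) (hG : digit_rearranging_function p r n G) :
  (@lebesgue_measure R).-integrable `[0%R, 1%R] (EFin \o G) /\
  (\int[@lebesgue_measure R]_(s in `[0%R, 1%R]) (G s)%:E)%E =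
  ((\sum_(j < q | (0 < j)%N) cumul r j * p j)
     / (1 - \sum_(j < q) p j * r j))%:E.
Proof.
have [n_gt0 n_inj _] := hn.
have /choice[i hi] : forall s : R, exists i : nat -> 'I_q, s \in `[0, 1] ->
    s = expansion p i /\ G s = expansion r (fun k => i (n k)).
  move=> s; have [s01|s01] := boolP (s \in `[0, 1]).
    by have [i si Gi] := hG s s01; exists i.
  by exists (fun=> Ordinal hq).
pose d s k := i s k.+1.
(* Both indices shift to start at 0. The predecessor loses nothing because [n] is positive at
   positive arguments, so [m] inherits injectivity. *)
pose m k := (n k.+1).-1.
have dm s k : d s (m k) = i s (n k.+1) by rewrite /d /m prednK // n_gt0.
have minj : injective m.
  move=> j k mjk; have [//|/eqP jk] := eqVneq j k.
  have := n_inj j.+1 k.+1 isT isT (fun e => jk (succn_inj e)).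
  by rewrite -[n j.+1]prednK ?n_gt0 // -[n k.+1]prednK ?n_gt0 // -/(m j) mjk.
have hd s : s \in `[0, 1] -> forall K,
    cyl_left p (d s) K <= s <= cyl_left p (d s) K + cyl_width p (d s) K.
  (* Only the two bare occurrences of [s] become its expansion; those inside [d s] must stay. *)
  by move=> s01 K; have [+ _] := hi s s01 => {2 3}->; exact: expansion_cyl.
pose f k s : \bar R :=
  (cumul r (d s (m k)) * cyl_width r (fun j => d s (m j)) k)%:E.
have f0 k s : (0 <= f k s)%E.
  by rewrite lee_fin mulr_ge0 ?cumul_ge0 // ltW // cyl_width_gt0.
have GE s : s \in `[0, 1] -> (G s)%:E = (\big[+%E/0%E]_(0 <= k <oo) f k s)%E.
  move=> s01; have [_ ->] := hi s s01; apply/esym/cvg_lim => //.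
  apply: cvg_EFin; first by apply: nearW => K; rewrite sumEFin.
  rewrite [X in X @ _ --> _](_ : _ =
    cyl_left r (fun k => i s (n k.+1))); last first.
    apply/funext => K /=; rewrite sumEFin /= big_mkord; apply: eq_bigr => k _.
    by rewrite dm; congr (_ * _); apply: eq_bigr => j _; rewrite dm.
  exact: cyl_left_cvg.
have mD : measurable (`[0, 1] : set R) by exact: measurable_itv.
set A := \sum_(j < q) p j * r j.
set B := \sum_(j < q | (0 < j)%N) cumul r j * p j.
have A0 : 0 <= A by apply: sumr_ge0 => j _; rewrite mulr_ge0 ?ltW.
(* As 1 < q, each digit j has another digit of positive weight beside it, so [r j] < 1. Hence [A] is
   strictly below the sum of the [p j], which is 1. *)
have A1 : `|A| < 1.
  rewrite ger0_norm // -hp1; apply: ltr_sum => [|j _].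
    by apply/hasP; exists (Ordinal hq) => //; rewrite mem_index_enum.
  rewrite gtr_pMr // -hr1 (bigD1 j) //= ltrDl.
  have [c cj] : exists c : 'I_q, c != j.
    have [->|j0] := eqVneq j (Ordinal hq); last by exists (Ordinal hq); rewrite eq_sym.
    by exists (Ordinal (ltnW hq)).
  rewrite (bigD1 c) //= ltr_wpDr //; apply: sumr_ge0 => l _; exact: ltW.
have [mf If] : (forall k, measurable_fun (`[0%R, 1%R] : set R) (f k)) /\
   forall k, (\int[@lebesgue_measure R]_(s in `[0%R, 1%R]) f k s)%E
     = (B * A ^+ k)%:E.
  have fT k := integral_digit_term k hp hp1 hr hd minj.
  split=> k; first by have [] := fT k.
  have [_ ->] := fT k; congr (_ * _ ^+ _)%:E.
    (* The full sum may drop the digit 0, since [cumul r] is an empty sum there. *)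
    rewrite /B [RHS]big_mkcond; apply: eq_bigr => j _; case: posnP => //= j0.
    by rewrite /cumul big_pred0 ?mul0r // => l; rewrite j0.
  by apply: eq_bigr => j _; rewrite mulrC.
have IG : (\int[@lebesgue_measure R]_(s in `[0%R, 1%R]) (G s)%:E)%E
    = (B / (1 - A))%:E.
  transitivity (\int[@lebesgue_measure R]_(s in `[0%R, 1%R])
      \big[+%E/0%E]_(0 <= k <oo) f k s)%E.
    by apply: eq_integral => s; rewrite inE => /GE.
  (* Monotone convergence for the nonnegative terms; what remains is the geometric series with ratio
     [A]. *)
  rewrite (integral_nneseries (@lebesgue_measure R) mD mf) //.
  apply/cvg_lim => //.
  apply: cvg_EFin.
    by apply: nearW => K; rewrite (eq_bigr _ (fun k _ => If k)) sumEFin.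
  rewrite [X in X @ _ --> _](_ : _ = series (geometric B A)).
    exact: cvg_geometric_series.
  by apply/funext => K /=; rewrite (eq_bigr _ (fun k _ => If k)) sumEFin.
(* [G] is measurable on the unit interval as a sum of measurable nonnegative terms. Being
   nonnegative there, it equals its absolute value, whose integral is the finite number just
   computed. *)
split=> //; apply/integrableP; split.
  apply: (eq_measurable_fun (fun s => \big[+%E/0%E]_(0 <= k <oo) f k s)).
    by move=> s; rewrite inE => /GE/esym.
  exact: ge0_emeasurable_sum.
rewrite (_ : integral _ _ _ = (B / (1 - A))%:E) ?ltry // -IG.
apply: eq_integral => s; rewrite inE => /GE Gs; rewrite [(EFin \o G) s]Gs Gs.
by rewrite gee0_abs // nneseries_ge0.
Qed.
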